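(* The simply connected nilpotent Lie groups $S_{10}^0$, $S_{16}^0$ and $S_{16}^1$ have lattices.
   Context: A lattice in a simply connected solvable Lie group $G$ is a discrete subgroup $\Gamma$ with $\Gamma\backslash G$ compact. For $A\in\mathfrak{gl}(11,\mathbb{R})$, the simply connected Lie group with Lie algebra $\mathbb{R}e_0\ltimes_A\mathbb{R}^{11}$ ($\mathbb{R}^{11}$ an abelian ideal, $[e_0,v]=Av$) is $\mathbb{R}\times\mathbb{R}^{11}$ with product $(t,v)(s,w)=(t+s,v+e^{tA}w)$. Let $U=\begin{bmatrix}0&0&0\\ 1&0&0\\ 0&1&0\\ 0&0&1\end{bmatrix}$. In blocks of sizes $3,4,4$, $S_{10}^0$ and $S_{16}^s$ ($s=0,1$) are the groups corresponding respectively to $$A=\begin{bmatrix}0_3&0&0\\ U&0_4&0\\ 0&0&0_4\end{bmatrix},\qquad A=\begin{bmatrix}0_3&0&0\\ sU&0_4&0\\ 0&I_4&0_4\end{bmatrix}.$$ *)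

(* Defs.v *)
From HB Require Import structures.
From mathcomp Require Import all_boot all_order all_algebra.
From mathcomp Require Import generic_quotient.
From mathcomp Require Import all_classical all_reals all_analysis.
From mathcomp Require Import ring lra.

Set Implicit Arguments.
Unset Strict Implicit.
Unset Printing Implicit Defensive.

Import Order.TTheory GRing.Theory Num.Theory.
Import numFieldNormedType.Exports.
Local Open Scope classical_set_scope.
Local Open Scope ring_scope.

Section CauchyProduct.
Context {R : realType} {V : lmodType R}.
Implicit Types (F : nat -> V) (t s : R).

Lemma sum_triangle (G : nat -> nat -> V) N :
  \sum_(0 <= i < N) \sum_(0 <= j < N - i) G i j =
  \sum_(0 <= k < N) \sum_(0 <= i < k.+1) G i (k - i)%N.
Proof.
elim: N => [|N IH]; first by rewrite !big_geq.
rewrite [RHS]big_nat_recr//= -IH [in RHS]big_nat_recr//= addrA -big_split/=.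
rewrite big_nat_recr//= subnn subSnn big_nat1; congr (_ + _).
by apply: eq_big_nat => i /andP[_ iN]; rewrite subSn 1?ltnW// big_nat_recr.
Qed.

Lemma exp_coeffD t s k : exp_coeff (t + s) k =
  \sum_(0 <= i < k.+1) exp_coeff t i * exp_coeff s (k - i)%N.
Proof.
rewrite /exp_coeff /= addrC exprDn big_mkord mulr_suml.
apply: eq_bigr => -[i /=]; rewrite ltnS => ik _.
have -> : (k`!%:R : R) = ('C(k, i))%:R * (i`!%:R * (k - i)`!%:R).
  by rewrite -!natrM bin_fact.
rewrite -mulr_natr.
by field; rewrite !pnatr_eq0 -!lt0n bin_gt0 ik !fact_gt0.
Qed.

Lemma series_exp_coeffD F t s N :
  \sum_(0 <= i < N) \sum_(0 <= j < N)
    (exp_coeff t i * exp_coeff s j) *: F (i + j)%N -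
  \sum_(0 <= k < N) exp_coeff (t + s) k *: F k =
  \sum_(0 <= i < N) \sum_(0 <= j < N | (N <= i + j)%N)
    (exp_coeff t i * exp_coeff s j) *: F (i + j)%N.
Proof.
pose G i j := (exp_coeff t i * exp_coeff s j) *: F (i + j)%N.
have -> : \sum_(0 <= k < N) exp_coeff (t + s) k *: F k =
    \sum_(0 <= k < N) \sum_(0 <= i < k.+1) G i (k - i)%N.
  apply: eq_bigr => k _; rewrite exp_coeffD scaler_suml.
  by apply: eq_big_nat => i /andP[_ ik]; rewrite /G subnKC.
rewrite -sum_triangle -sumrB; apply: eq_big_nat => i /andP[_ iN].
rewrite (bigID (fun j => N <= i + j)%N)/= -[LHS]addrA -[RHS]addr0.
congr (_ + _); apply/eqP; rewrite subr_eq0; apply/eqP.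
rewrite [RHS](big_nat_widen _ _ N) ?leq_subr//.
by apply: eq_bigl => j; rewrite -ltnNge ltn_subRL.
Qed.
End CauchyProduct.

HB.instance Definition _ (R : realType) (m n : nat) := Complete.on 'M[R]_(m, n).

Section MatrixExponential.
Context {R : realType} {n : nat}.
Implicit Types (A : 'M[R]_n) (t s : R).

Definition expmx_coeff A : ('M[R]_n)^nat := fun k => k`!%:R^-1 *: A ^+ k.

Definition expmx A : 'M[R]_n := limn (series (expmx_coeff A)).

Let abound A : R := \sum_i \sum_j `|A i j|.

Let abound_ge0 A : 0 <= abound A.
Proof. by apply: sumr_ge0 => i _; apply: sumr_ge0. Qed.

Lemma entry_expr_le A k i j : `|(A ^+ k) i j| <= abound A ^+ k.
Proof.
elim: k i j => [|k IH] i j.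
  by rewrite !expr0 mxE; case: (i == j); rewrite ?normr1 ?normr0 ?ler01.
rewrite !exprS mxE (le_trans (ler_norm_sum _ _ _))//.
apply: (@le_trans _ _ (\sum_l `|A i l| * abound A ^+ k)).
  by apply: ler_sum => l _; rewrite normrM ler_wpM2l.
rewrite -mulr_suml ler_wpM2r ?exprn_ge0//.
rewrite [leRHS](bigD1 i)//= lerDl.
by apply: sumr_ge0 => i' _; apply: sumr_ge0.
Qed.

Lemma norm_expr_le A k : `|A ^+ k| <= abound A ^+ k.
Proof.
rewrite [leLHS]/Num.norm/= mx_normrE; apply/bigmax_leP; split => [|[i j] _ /=].
  exact: exprn_ge0.
exact: entry_expr_le.
Qed.

Lemma exprZmx t A k : (t *: A) ^+ k = t ^+ k *: A ^+ k.
Proof.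
elim: k => [|k IH]; first by rewrite !expr0 scale1r.
by rewrite !exprS IH -!mulmxE -scalemxAl -scalemxAr scalerA.
Qed.

Lemma expmx_coeffZ t A k : expmx_coeff (t *: A) k = exp_coeff t k *: A ^+ k.
Proof. by rewrite /expmx_coeff exprZmx scalerA mulrC. Qed.

Lemma is_cvg_expmx A : cvgn (series (expmx_coeff A)).
Proof.
apply: normed_cvg; apply: series_le_cvg (is_cvg_series_exp_coeff (abound A)).
- by move=> k; exact: normr_ge0.
- by move=> k; exact: exp_coeff_ge0.
- move=> k; rewrite /expmx_coeff /exp_coeff /= normrZ mulrC.
  by rewrite ger0_norm ?invr_ge0// ler_wpM2r ?invr_ge0// norm_expr_le.
Qed.

Lemma expmx_entry_cvg A i j :
  (fun N => series (expmx_coeff A) N i j) @ \oo --> expmx A i j.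
Proof.
apply: (@continuous_cvg _ _ _ _ _ _ (fun M : 'M[R]_n => M i j)).
  exact: coord_continuous.
exact: is_cvg_expmx.
Qed.

Lemma expmx0 : expmx 0 = 1%:M.
Proof.
apply: cvg_lim => //; rewrite -(cvg_shiftS (series _)).
apply: (@cvg_near_cst _ _ _ _ _ eventually_filter).
apply: nearW => k /=; apply/eqP.
rewrite /series/= big_nat_recl// big1_seq ?addr0.
  by rewrite /expmx_coeff expr0 fact0 invr1 scale1r.
by move=> l _; rewrite /expmx_coeff expr0n /= scaler0.
Qed.

Lemma expmxD A t s :
  expmx ((t + s) *: A) = expmx (t *: A) *m expmx (s *: A).
Proof.
set a := abound A; have a0 : 0 <= a by exact: abound_ge0.
apply/matrixP => i j; rewrite mxE; apply/eqP; rewrite eq_sym -subr_eq0.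
apply/eqP.
pose S u N := series (expmx_coeff (u *: A)) N.
pose D N := \sum_l S t N i l * S s N l j - S (t + s) N i j.
have D_lim : D @ \oo --> \sum_l expmx (t *: A) i l * expmx (s *: A) l j -
    expmx ((t + s) *: A) i j.
  apply: cvgB; last exact: expmx_entry_cvg.
  apply: (cvg_big add_continuous) => l _.
  by apply: cvgM; exact: expmx_entry_cvg.
pose e u := series (exp_coeff (u * a)).
pose E N := e `|t| N * e `|s| N - e (`|t| + `|s|) N.
have E_lim : E @ \oo --> (0 : R).
  have -> : 0 = expR (`|t| * a) * expR (`|s| * a) - expR ((`|t| + `|s|) * a).
    by rewrite mulrDl expRD subrr.
  apply: cvgB; last exact: is_cvg_series_exp_coeff.
  by apply: cvgM; exact: is_cvg_series_exp_coeff.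
have SE u N : S u N = \sum_(0 <= k < N) exp_coeff u k *: A ^+ k.
  by rewrite /S /series/=; apply: eq_bigr => k _; rewrite expmx_coeffZ.
have eE u N : e u N = \sum_(0 <= k < N) exp_coeff u k * a ^+ k.
  rewrite /e /series/=; apply: eq_bigr => k _.
  by rewrite /exp_coeff/= exprMn mulrAC.
have DE N : D N = (\sum_(0 <= p < N) \sum_(0 <= q < N | (N <= p + q)%N)
    (exp_coeff t p * exp_coeff s q) *: A ^+ (p + q)%N) i j.
  rewrite -(series_exp_coeffD (fun k => A ^+ k)) -!SE /D.
  rewrite [RHS]mxE [in RHS]mxE; congr (_ - _).
  transitivity ((S t N *m S s N) i j); first by rewrite mxE.
  rewrite !SE mulmx_suml; congr (fun_of_matrix _ i j).
  apply: eq_bigr => p _; rewrite mulmx_sumr; apply: eq_bigr => q _.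
  by rewrite -scalemxAl -scalemxAr scalerA exprD.
have EE N : E N = \sum_(0 <= p < N) \sum_(0 <= q < N | (N <= p + q)%N)
    (exp_coeff `|t| p * exp_coeff `|s| q) * a ^+ (p + q)%N.
  rewrite -(@series_exp_coeffD _ R^o (fun k => a ^+ k)) -/(e _ N).
  rewrite /E !eE; congr (_ - _).
  rewrite mulr_suml; apply: eq_bigr => p _; rewrite mulr_sumr.
  by apply: eq_bigr => q _; rewrite mulrACA -exprD.
have DEle N : `|D N| <= E N.
  rewrite DE EE summxE (le_trans (ler_norm_sum _ _ _))//; apply: ler_sum => p _.
  rewrite summxE (le_trans (ler_norm_sum _ _ _))//; apply: ler_sum => q _.
  rewrite mxE normrM /exp_coeff/= ler_pM ?normr_ge0 ?entry_expr_le//.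
  by rewrite !normrM !normrX !normfV !normr_nat.
have D0 : D @ \oo --> (0 : R).
  apply/cvgr0Pnorm_lt => /= x x0; near=> N.
  rewrite (le_lt_trans (DEle N))// (le_lt_trans (ler_norm _))//.
  near: N; move/cvgr0Pnorm_lt : E_lim; exact.
by rewrite -(cvg_lim _ D_lim)// (cvg_lim _ D0).
Unshelve. all: by end_near. Qed.
End MatrixExponential.

(* The simply connected Lie group with Lie algebra R e_0 |x_A R^n, where
   [e_0, v] = A v: the space R x R^n with (t, v)(s, w) = (t + s, v + e^(tA) w);
   R^n is the space of column vectors. *)
Definition semidirect_line {R : realType} {n : nat} (A : 'M[R]_n) : Type :=
  (R * 'cV[R]_n)%type.

Section SemidirectLine.
Context {R : realType} {n : nat} (A : 'M[R]_n).
Local Notation G := (semidirect_line A).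

HB.instance Definition _ := Choice.copy G (R * 'cV[R]_n)%type.
HB.instance Definition _ := Topological.copy G (R * 'cV[R]_n)%type.

Definition sl_one : G := (0, 0).
Definition sl_mul (x y : G) : G := (x.1 + y.1, x.2 + expmx (x.1 *: A) *m y.2).
Definition sl_inv (x : G) : G := (- x.1, - (expmx (- x.1 *: A) *m x.2)).

Fact sl_mulA : associative sl_mul.
Proof.
move=> [t u] [s v] [r w]; congr (_, _) => /=; first by rewrite addrA.
by rewrite mulmxDr expmxD mulmxA addrA.
Qed.

Fact sl_mul1x : left_id sl_one sl_mul.
Proof.
by move=> [t v]; congr (_, _); rewrite /= ?scale0r ?expmx0 ?mul1mx add0r.
Qed.

Fact sl_mulx1 : right_id sl_one sl_mul.
Proof. by move=> [t v]; congr (_, _); rewrite /= ?mulmx0 addr0. Qed.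

Fact sl_mulVx : left_inverse sl_one sl_inv sl_mul.
Proof. by move=> [t v]; congr (_, _); rewrite /= addNr. Qed.

Fact sl_mulxV : right_inverse sl_one sl_inv sl_mul.
Proof.
move=> [t v]; congr (_, _); rewrite /= ?subrr//.
by rewrite mulmxN mulmxA -expmxD subrr scale0r expmx0 mul1mx subrr.
Qed.

HB.instance Definition _ := isGroup.Build G
  sl_mulA sl_mul1x sl_mulx1 sl_mulVx sl_mulxV.

End SemidirectLine.

Section Lattice.
Local Open Scope quotient_scope.
Context {R : realType} {n : nat} {A : 'M[R]_n}.
Local Notation G := (semidirect_line A).
Implicit Types (Gamma : set G) (x y : G).

Definition right_coset Gamma x : set G := [set (g * x)%g | g in Gamma].

Definition same_right_coset Gamma : rel G :=
  fun x y => right_coset Gamma x == right_coset Gamma y.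

Fact same_right_coset_equiv Gamma : equiv_class_of (same_right_coset Gamma).
Proof.
by split=> [x|x y|y x z] /=; rewrite /same_right_coset // => /eqP ->.
Qed.

Canonical same_right_coset_rel Gamma :=
  EquivRelPack (same_right_coset_equiv Gamma).

(* Gamma\G with the quotient topology *)
Definition right_coset_space Gamma : topologicalType :=
  quotient_topology {eq_quot same_right_coset Gamma}.

Definition is_lattice Gamma : Prop :=
  [/\ group_closed (mem Gamma),
      Gamma `<=` isolated Gamma &
      compact [set: right_coset_space Gamma]].

End Lattice.

(* the group attached to A has a lattice *)
Definition has_lattice {R : realType} {n : nat} (A : 'M[R]_n) : Prop :=
  exists Gamma : set (semidirect_line A), is_lattice Gamma.

Section Matrices.
Context {R : realType}.

Definition U_mx : 'M[R]_(4, 3) := \matrix_(i, j) (val i == (val j).+1)%:R.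

(* Block sizes 3, 4, 4, grouped as 3 + (4 + 4). *)
Definition S10_0_mx : 'M[R]_11 :=
  block_mx (0 : 'M[R]_3)       (0 : 'M[R]_(3, 4 + 4))
           (col_mx U_mx 0)  (block_mx 0 0 0 0 : 'M[R]_(4 + 4)).

Definition S16_mx (s : R) : 'M[R]_11 :=
  block_mx (0 : 'M[R]_3)               (0 : 'M[R]_(3, 4 + 4))
           (col_mx (s *: U_mx) 0)   (block_mx 0 0 1%:M 0 : 'M[R]_(4 + 4)).

End Matrices.

(* Main.v *)
(* If A has integer entries and A^m = 0, the exponential series of A stops before
   degree m, and its denominators k! divide (m!)^k.  Hence e^(m! z A) is an
   integer matrix for every integer z, so (m! Z) x Z^n is a subgroup of
   R x R^n; the compact box [0, m!] x [0, 1]^n meets all its cosets.  The three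
   matrices of the theorem are integral with A^3 = 0. *)
Require Import Defs.
From mathcomp Require Import all_boot all_order all_algebra.
From mathcomp Require Import all_classical all_reals all_analysis.

Set Implicit Arguments.
Unset Strict Implicit.
Unset Printing Implicit Defensive.

Import Order.TTheory GRing.Theory Num.Theory.
Import numFieldNormedType.Exports.
Local Open Scope classical_set_scope.
Local Open Scope ring_scope.

Lemma mxOver_sum (M : zmodType) (S : addrClosed M) p q (I : Type) (r : seq I)
    (F : I -> 'M[M]_(p, q)) :
  (forall i, F i \is a mxOver S) -> \sum_(i <- r) F i \is a mxOver S.
Proof. by move=> SF; apply: rpred_sum. Qed.

Lemma mxOverB (M : zmodType) (S : zmodClosed M) p q :
  {in mxOver S &, forall u v : 'M[M]_(p, q), u - v \is a mxOver S}.
Proof. by move=> u v; exact: rpredB. Qed.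

Lemma mxOver_int_fact_expr (R : realType) n (A : 'M[R]_n) k m x :
  (k <= m)%N -> x \is a Num.int -> A \is a mxOver Num.int ->
  k`!%:R^-1 *: (((m`!%:R * x) *: A) ^+ k) \is a mxOver Num.int.
Proof.
move=> km xint Aint; have kdvd : (k`! %| m`! ^ k)%N.
  (* For positive [k], the identity expressing [m!] through a binomial coefficient shows that [k!]
     divides one factor [m!] of the power; [k = 0] is apart because that power is empty. *)
  case: k km => [_|k km]; first by rewrite fact0 dvd1n.
  by rewrite expnS dvdn_mulr// -(bin_fact km) dvdn_mull// dvdn_mulr.
rewrite exprZmx scalerA mulrC exprMn mulrAC -natrX -natf_div//.
apply: mxOverZ; first by rewrite rpredM ?natr_int ?rpredX.
elim: k {km kdvd} => [|k IH].
  by rewrite expr0; exact: mxOver_scalar (rpred0 _) (rpred1 _).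
by rewrite exprS; exact: mxOverM.
Qed.

(** The partial sums are constant from index [m] on, and the limit is that constant. *)
Lemma expmx_nilpotent (R : realType) n (A : 'M[R]_n) m :
  A ^+ m = 0 -> expmx A = \sum_(k < m) k`!%:R^-1 *: A ^+ k.
Proof.
move=> Am0; apply: cvg_lim => //.
apply: (@cvg_near_cst _ _ _ _ _ eventually_filter).
exists m => // k /= mk; apply/eqP.
rewrite /series/= (big_cat_nat (n := m))//= [X in _ + X]big_nat_cond.
rewrite [X in _ + X]big1 ?addr0 ?big_mkord// => i /andP[/andP[mi _] _].
by rewrite /expmx_coeff -(subnK mi) exprD Am0 mulr0 scaler0.
Qed.

Lemma cV_compact (T : ptopologicalType) n (B : set T) :
  compact B -> compact [set v : 'cV[T]_n | forall i, B (v i ord0)].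
Proof.
move=> Bc; have -> : [set v : 'cV[T]_n | forall i, B (v i ord0)] =
    trmx @` [set v : 'rV[T]_n | forall i, B (v ord0 i)].
  apply/seteqP; split=> [v Bv|_ [v Bv <-] i]; last by rewrite mxE; exact: Bv.
  by exists v^T; rewrite ?trmxK// => i; rewrite mxE.
apply: continuous_compact; last exact: (@rV_compact _ _ (fun=> B)).
apply: continuous_subspaceT => v Q [P vP PQ].
(* A neighbourhood of a matrix contains a product of neighbourhoods of its entries; transposing the
   family [P] around [v^T] gives one around [v]. *)
exists (fun i j => P j i) => [i j|w wP /=].
  by have := vP j i; rewrite mxE.
by apply: PQ => i j; rewrite mxE; exact: wP.
Qed.

Lemma right_coset_mull (R : realType) n (A : 'M[R]_n)
    (Gamma : set (semidirect_line A)) g x :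
  group_closed (mem Gamma) -> Gamma g ->
  right_coset Gamma (g * x)%g = right_coset Gamma x.
Proof.
move=> Ggr /mem_set gG; apply/seteqP; split=> _ [h /mem_set hG <-].
  by exists (h * g)%g; [exact/set_mem/(group_closedM Ggr) | rewrite mulgA].
exists (h / g)%g; first exact/set_mem/(Ggr.2).
by rewrite mulgA mulgVK.
Qed.

Section NilpotentIntegerMatrix.
Context {R : realType} {n m : nat} (A : 'M[R]_n).
Hypotheses (A_int : A \is a mxOver Num.int) (A_nil : A ^+ m = 0).
Local Notation G := (semidirect_line A).

Lemma expmx_int x : x \is a Num.int ->
  expmx ((m`!%:R * x) *: A) \is a mxOver Num.int.
Proof.
move=> xint; rewrite (@expmx_nilpotent _ _ _ m); last first.
  by rewrite exprZmx A_nil scaler0.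
apply: mxOver_sum => k.
exact: mxOver_int_fact_expr (ltnW (ltn_ord k)) xint A_int.
Qed.

Definition int_lattice : set G :=
  [set x | x.1 / m`!%:R \is a Num.int /\ x.2 \is a mxOver Num.int].

Lemma int_lattice_group : group_closed (mem int_lattice).
Proof.
split=> [|x y]; rewrite !inE.
  by split=> /=; [rewrite mul0r | exact: mxOver0].
move=> [x1 x2] [y1 y2]; split=> /=; first by rewrite mulrBl rpredB.
have expint z : z / m`!%:R \is a Num.int ->
    expmx (z *: A) \is a mxOver Num.int.
  by move/expmx_int; rewrite mulrC divfK// pnatr_eq0 -lt0n fact_gt0.
(* The vector part of [x / y] is x.2 - e^(x.1 A) e^(- y.1 A) y.2. *)
rewrite mulmxN; apply: mxOverB => //.
apply: mxOverM; first exact: expint.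
by apply: mxOverM => //; apply: expint; rewrite mulNr rpredN.
Qed.

(** Distinct integers are at distance at least 1, so the unit ball around a point of the subgroup
    contains no other one. *)
Lemma int_lattice_discrete : int_lattice `<=` isolated int_lattice.
Proof.
move=> x xG; split; first exact: mem_set.
exists (ball (x : R * 'cV[R]_n) 1); first exact: nbhsx_ballx.
apply/seteqP; split=> [y [[xy1 [_ xy2]] [y1 y2]]|_ ->]; last first.
  by split=> //; exact: ballxx.
case: xG xy1 xy2 => x1 x2 xy1 xy2.
have eq_int (a b : R) : a \is a Num.int -> b \is a Num.int ->
    `|a - b| < 1 -> a = b.
  move=> aint bint ab; apply/eqP; rewrite -subr_eq0; apply: contraTT ab => ab.
  by rewrite -leNgt norm_intr_ge1// rpredB.
have f0 : 0 < m`!%:R :> R by rewrite ltr0n fact_gt0.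
apply/esym; rewrite [LHS]surjective_pairing [RHS]surjective_pairing; congr (_, _).
  (* The integers here are the time coordinates divided by [m!]; as [m!] is at least 1, their
     distance stays below 1. *)
  apply: (divIf (lt0r_neq0 f0)); apply: eq_int => //.
  rewrite -mulrBl normrM normfV (gtr0_norm f0) ltr_pdivrMr// mul1r.
  by rewrite (lt_le_trans xy1)// ler1n fact_gt0.
apply/matrixP => i j; apply: eq_int; [exact/mxOverP|exact/mxOverP|exact: xy2].
Qed.

Lemma int_lattice_cocompact : compact [set: right_coset_space int_lattice].
Proof.
pose K : set G :=
  `[0, m`!%:R]%classic `*` [set v : 'cV[R]_n | forall i, v i ord0 \in `[0, 1]].
have Kc : compact K.
  apply: compact_setX; first exact: segment_compact.
  exact: (cV_compact (@segment_compact R 0 1)).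
pose pi : G -> right_coset_space int_lattice :=
  \pi_(right_coset_space int_lattice)%qT.
have -> : [set: right_coset_space int_lattice] = pi @` K.
  apply/seteqP; split=> // q _.
  have f0 : m`!%:R != 0 :> R by rewrite pnatr_eq0 -lt0n fact_gt0.
  (* Reduction of [x] into the box in two steps: translating by the inverse of [(m! t, 0)] brings
     the time into [0, m!] and the vector to [u], then translating by [(0, - w)] leaves the
     fractional parts of [u]. Thus [g] is the product of [(m! t, 0)] and [(0, w)], and [y] is g^-1
     x. *)
  pose x : G := repr q; pose t := Num.floor (x.1 / m`!%:R).
  pose E z := expmx ((m`!%:R * z%:~R) *: A).
  have EK z : E z *m E (- z) = 1%:M.
    by rewrite -expmxD mulrNz mulrN subrr scale0r expmx0.
  pose u := E (- t) *m x.2.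
  pose w : 'cV[R]_n := \col_i (Num.floor (u i ord0))%:~R.
  pose g : G := (m`!%:R * t%:~R, E t *m w).
  pose y : G := (x.1 - m`!%:R * t%:~R, u - w).
  have gG : int_lattice g.
    split=> /=; first by rewrite mulrC mulKf// intr_int.
    apply: mxOverM; first by rewrite expmx_int// intr_int.
    by apply/mxOverP => i j; rewrite mxE intr_int.
  have xE : x = (g * y)%g.
    rewrite [LHS]surjective_pairing; congr (_, _) => /=.
      by rewrite addrC subrK.
    by rewrite -mulmxDr addrC subrK mulmxA EK mul1mx.
  exists y.
    split=> [|i].
      rewrite /= in_itv/= subr_ge0 lerBlDl mulrC.
      rewrite -ler_pdivlMr ?lt0r ?f0//= floor_le/=.
      rewrite -[X in _ + X]mul1r -mulrDl -ler_pdivrMr ?lt0r ?f0//=.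
      by have := floorD1_gt (x.1 / m`!%:R); rewrite intrD; exact: ltW.
    rewrite in_itv/= [_ i _]mxE [(- w) _ _]mxE [w _ _]mxE subr_ge0 floor_le/=.
    by rewrite lerBlDl; have := floorD1_gt (u i ord0); rewrite intrD; exact: ltW.
  (* Since [g] lies in the subgroup, [g * y] and [y] have the same right coset. *)
  rewrite -[q]reprK -/x xE; apply/eqmodP.
  apply/eqP/esym/right_coset_mull => //; exact: int_lattice_group.
apply: continuous_compact Kc; apply: continuous_subspaceT.
exact: pi_continuous.
Qed.

Lemma nilpotent_int_has_lattice : has_lattice A.
Proof.
exists int_lattice; split.
- exact: int_lattice_group.
- exact: int_lattice_discrete.
- exact: int_lattice_cocompact.
Qed.

End NilpotentIntegerMatrix.

(** The matrix carries the first block to the second by [V], the second to the third by [W], and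
    kills the third, so its cube vanishes. *)
Lemma block_has_lattice (R : realType) (p q r : nat)
    (V : 'M[R]_(q, p)) (W : 'M[R]_(r, q)) :
  V \is a mxOver Num.int -> W \is a mxOver Num.int ->
  has_lattice (block_mx (0 : 'M[R]_p) (0 : 'M[R]_(p, q + r))
    (col_mx V 0) (block_mx 0 0 W 0 : 'M[R]_(q + r))).
Proof.
move=> /mxOverP Vint /mxOverP Wint; apply: (@nilpotent_int_has_lattice _ _ 3).
  apply/mxOverP => i j.
  by repeat (rewrite !mxE; case: fintype.split => ?); rewrite ?mxE ?rpred0.
rewrite !exprS expr0 mulr1 -!mulmxE.
have zE := (mul0mx, mulmx0, addr0, add0r, col_mx0, row_mx0, block_mx0).
(* With N the lower right block and C the lower left one, the cube has bottom row (N^2 C, N^3) and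
   zero top row, so N^2 = 0 suffices. *)
have W0W : block_mx 0 0 W 0 *m block_mx 0 0 W 0 = 0 :> 'M[R]_(q + r).
  by rewrite mulmx_block !zE.
by rewrite mulmx_block mulmx_block !zE W0W !zE mulmxA W0W !zE.
Qed.

Theorem proposition6p3 (R : realType) :
  [/\ has_lattice (S10_0_mx : 'M[R]_11),
      has_lattice (S16_mx (0 : R)%R) &
      has_lattice (S16_mx (1 : R)%R)].
Proof.
have Uint : (U_mx : 'M[R]_(4, 3)) \is a mxOver Num.int.
  by apply/mxOverP => i j; rewrite mxE natr_int.
(* [S10_0_mx] is the case [V = U_mx], [W = 0]; [S16_mx s] is the case [V = s *: U_mx], [W = 1]. *)
split; apply: (@block_has_lattice R 3 4 4) => //.
- exact: mxOver0.
- by rewrite scale0r mxOver0.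
- exact: mxOver_scalar (rpred0 _) (rpred1 _).
- by rewrite scale1r.
- exact: mxOver_scalar (rpred0 _) (rpred1 _).
Qed.
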